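(* Let $S:\mathbb{R}^n\rightrightarrows\mathbb{R}^m$ be a set-valued mapping, $\bar{x}\in X\subset\mathbb{R}^n$, $\bar{u}\in S(\bar{x})$ and $\kappa\ge 0$. Suppose that $X$ is closed. If $S$ has the Lipschitz-like property relative to $X$ at $\bar{x}$ for $\bar{u}$ with constant $\kappa$, then the condition $$\max_{w\in T_X(x)\cap\mathbb{S}}\langle x^*,w\rangle\le\kappa\|u^*\|\qquad\text{for all } u^*\in\mathbb{R}^m \text{ and all } x^*\in\widehat{D}^*S|_X(x\mid u)(u^* )$$ holds for all $(x,u)$ close enough to $(\bar{x},\bar{u})$ in $\operatorname{gph}S|_X$.
   Context: $\|\cdot\|$ is the Euclidean norm, $\mathbb{B}$ the closed unit ball, $\mathbb{S}$ the unit sphere. A set $A$ is locally closed at $x\in A$ if $A\cap U$ is closed for some closed neighborhood $U$ of $x$. $\operatorname{gph}S=\{(x,u)\mid u\in S(x)\}$. The restricted mapping $S|_X$ is $S|_X(x)=S(x)$ if $x\in X$ and $S|_X(x)=\emptyset$ otherwise, so $\operatorname{gph}S|_X=\operatorname{gph}S\cap(X\times\mathbb{R}^m)$. Lipschitz-like property relative to $X$ at $\bar x$ for $\bar u$ with constant $\kappa\ge0$ (where $\bar x\in X$, $\bar u\in S(\bar x)$): $\operatorname{gph}S$ is locally closed at $(\bar{x},\bar{u})$ and there are neighborhoods $V$ of $\bar{x}$ and $W$ of $\bar{u}$ such that $S(x')\cap W\subset S(x)+\kappa\|x'-x\|\mathbb{B}$ for all $x,x'\in X\cap V$. For $x\in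 A$, the tangent (contingent) cone $T_A(x)$ consists of all $w$ for which there exist $t_k\downarrow0$ and $w_k\to w$ with $x+t_kw_k\in A$ for all $k$. The regular (Fréchet) normal cone is the polar $\widehat{N}_A(x)=\{v\mid\langle v,w\rangle\le0\ \forall w\in T_A(x)\}$. For $(x,u)\in\operatorname{gph}S|_X$, the regular coderivative $\widehat{D}^*S|_X(x\mid u):\mathbb{R}^m\rightrightarrows\mathbb{R}^n$ is defined by $x^*\in\widehat{D}^*S|_X(x\mid u)(u^* )\iff(x^*,-u^* )\in\widehat{N}_{\operatorname{gph}S|_X}(x,u)$. The maximum over an empty set is read as $-\infty$ (the condition is then vacuous). *)

(* Defs.v *)
From HB Require Import structures.
From mathcomp Require Import all_boot all_order all_algebra.
From mathcomp Require Import all_classical all_reals all_analysis.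

Set Implicit Arguments.
Unset Strict Implicit.
Unset Printing Implicit Defensive.

Import Order.TTheory GRing.Theory Num.Theory numFieldNormedType.Exports.

Local Open Scope classical_set_scope.
Local Open Scope ring_scope.

(* R^n is 'rV[R]_n and R^n x R^m is the product type, with the topologies of
   the library.  These come from the sup-norm and are the Euclidean topologies;
   the norm `| _ | of 'rV[R]_n is NOT the Euclidean norm, hence [enorm]. *)

Definition dotp (R : realType) (n : nat) (u v : 'rV[R]_n) : R :=
  \sum_(i < n) u 0 i * v 0 i.

Definition enorm (R : realType) (n : nat) (u : 'rV[R]_n) : R :=
  Num.sqrt (dotp u u).

Definition eunit_ball (R : realType) (n : nat) : set 'rV[R]_n :=
  [set b | enorm b <= 1].

Definition eunit_sphere (R : realType) (n : nat) : set 'rV[R]_n :=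
  [set w | enorm w = 1].

Definition dotp_pair (R : realType) (n m : nat)
    (p q : 'rV[R]_n * 'rV[R]_m) : R :=
  dotp p.1 q.1 + dotp p.2 q.2.

Definition locally_closed_at (T : topologicalType) (A : set T) (x : T) : Prop :=
  exists U : set T, [/\ nbhs x U, closed U & closed (A `&` U)].

Definition gph (T U : Type) (S : T -> set U) : set (T * U) :=
  [set z | S z.1 z.2].

Definition restrict_map (T U : Type) (S : T -> set U) (X : set T) :
    T -> set U :=
  patch (fun=> set0) X S.

Definition lipschitz_like (R : realType) (n m : nat)
    (S : 'rV[R]_n -> set 'rV[R]_m) (X : set 'rV[R]_n)
    (xbar : 'rV[R]_n) (ubar : 'rV[R]_m) (kappa : R) : Prop :=
  locally_closed_at (gph S) (xbar, ubar) /\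
  exists V : set 'rV[R]_n, exists W : set 'rV[R]_m,
    [/\ nbhs xbar V, nbhs ubar W &
      forall x x', (X `&` V) x -> (X `&` V) x' ->
        S x' `&` W `<=`
          [set u + (kappa * enorm (x' - x)) *: b
            | u in S x & b in @eunit_ball R m]].

(* t_k \downarrow 0 means t_k > 0 and t_k --> 0; monotonicity is not required. *)
Definition tangent_cone (R : realType) (V : normedModType R)
    (A : set V) (x : V) : set V :=
  [set w | exists t : nat -> R, exists wk : nat -> V,
    [/\ forall k, 0 < t k, t @ \oo --> 0, wk @ \oo --> w &
        forall k, A (x + t k *: wk k)]].

Definition regular_normal_cone (R : realType) (n m : nat)
    (A : set ('rV[R]_n * 'rV[R]_m)) (z : 'rV[R]_n * 'rV[R]_m) :
    set ('rV[R]_n * 'rV[R]_m) :=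
  [set v | forall w, tangent_cone A z w -> dotp_pair v w <= 0].

Definition regular_coderivative (R : realType) (n m : nat)
    (S : 'rV[R]_n -> set 'rV[R]_m) (x : 'rV[R]_n) (u : 'rV[R]_m) :
    'rV[R]_m -> set 'rV[R]_n :=
  fun us => [set xs | regular_normal_cone (gph S) (x, u) (xs, - us)].

(* [is_emax A M]: M is the maximum of A, attained when A is nonempty, and -oo
   when A is empty. *)
Definition is_emax (R : realType) (A : set \bar R) (M : \bar R) : Prop :=
  (A M /\ ubound A M) \/ (A = set0 /\ M = -oo%E).

Definition coderivative_condition (R : realType) (n m : nat)
    (S : 'rV[R]_n -> set 'rV[R]_m) (X : set 'rV[R]_n) (kappa : R)
    (x : 'rV[R]_n) (u : 'rV[R]_m) : Prop :=
  forall (us : 'rV[R]_m) (xs : 'rV[R]_n),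
    regular_coderivative (restrict_map S X) x u us xs ->
    exists M : \bar R,
      is_emax [set (dotp xs w)%:E
                | w in tangent_cone X x `&` @eunit_sphere R n] M /\
      (M <= (kappa * enorm us)%:E)%E.

(* Main.v *)
Require Import Defs.
From HB Require Import structures.
From mathcomp Require Import all_boot all_order all_algebra.
From mathcomp Require Import all_classical all_reals all_analysis.
From mathcomp Require Import ring lra.

Import Order.TTheory GRing.Theory Num.Theory numFieldNormedType.Exports.

Local Open Scope classical_set_scope.
Local Open Scope ring_scope.

(** Fix [(x, u)] in the graph of the restriction, so close to [(xbar, ubar)]
    that [x] is interior to [V] and [u] lies in [W], and let [w] be a unit
    tangent vector to [X] at [x], the limit of [w_k] with [x + t_k w_k] in
    [X].  The Lipschitz-like inclusion, applied from [x] to [x + t_k w_k],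
    writes [u] as a point of [S (x + t_k w_k)] plus
    [kappa t_k |w_k| b_k] with [b_k] in the unit ball.  Hence the graph contains
    [(x, u) + t_k (w_k, - kappa |w_k| b_k)], and by compactness of the ball
    [(w, - kappa b)] is tangent to the graph for some cluster point [b] of the
    [b_k] ([lipschitz_tangent_lift]).  Pairing this vector with the regular
    normal [(xs, - us)] gives [<xs, w> <= - kappa <us, b>], which is at most
    [kappa |us|] by Cauchy-Schwarz ([coderivative_tangent_le]).

    The supremum is attained because tangent cones are closed
    ([closed_tangent_cone]) and the unit sphere is compact, so a continuous
    function has a maximum on their intersection unless the latter is empty.

    Both limit arguments use the description of tangency by neighbourhoods
    ([tangent_coneP]), which spares the extraction of subsequences. *)

(** * Euclidean inner product and norm *)

Section Euclidean.
Variables (R : realType) (n : nat).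
Implicit Types u v w : 'rV[R]_n.

Lemma dotpC u v : dotp u v = dotp v u.
Proof. by apply: eq_bigr => i _; rewrite mulrC. Qed.

Lemma dotpZr a u v : dotp u (a *: v) = a * dotp u v.
Proof.
by rewrite /dotp mulr_sumr; apply: eq_bigr => i _; rewrite mxE mulrCA.
Qed.

Lemma dotpZl a u v : dotp (a *: u) v = a * dotp u v.
Proof. by rewrite dotpC dotpZr dotpC. Qed.

Lemma dotpNl u v : dotp (- u) v = - dotp u v.
Proof. by rewrite -scaleN1r dotpZl mulN1r. Qed.

Lemma dotp_ge0 u : 0 <= dotp u u.
Proof. by apply: sumr_ge0 => i _; rewrite -expr2 sqr_ge0. Qed.

Lemma enorm_ge0 u : 0 <= enorm u.
Proof. exact: sqrtr_ge0. Qed.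

Lemma sqr_enorm u : enorm u ^+ 2 = dotp u u.
Proof. by rewrite sqr_sqrtr ?dotp_ge0. Qed.

Lemma enormZ a u : enorm (a *: u) = `|a| * enorm u.
Proof.
by rewrite /enorm dotpZl dotpZr mulrA -expr2 sqrtrM ?sqr_ge0// sqrtr_sqr.
Qed.

Lemma coord_le_enorm u i : `|u 0 i| <= enorm u.
Proof.
rewrite -sqrtr_sqr ler_wsqrtr// /dotp (bigD1 i)//= -expr2 lerDl.
by apply: sumr_ge0 => j _; rewrite -expr2 sqr_ge0.
Qed.

Lemma enorm_eq0 u : enorm u = 0 -> u = 0.
Proof.
move=> u0; apply/rowP => i; rewrite mxE; apply/eqP.
by rewrite -normr_le0 -u0 coord_le_enorm.
Qed.

Lemma cauchy_schwarz u v : `|dotp u v| <= enorm u * enorm v.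
Proof.
have [v0|v0] := eqVneq (enorm v) 0.
  rewrite v0 (enorm_eq0 _ v0) -(scale0r (0 : 'rV[R]_n)).
  by rewrite dotpZr mul0r normr0 mulr0.
rewrite -(ler_pXn2r (n := 2)) ?nnegrE ?mulr_ge0 ?enorm_ge0//.
rewrite real_normK ?num_real// exprMn !sqr_enorm.
have v_gt0 : 0 < dotp v v by rewrite -sqr_enorm exprn_gt0// lt_def v0 enorm_ge0.
rewrite -(ler_pM2l v_gt0) -subr_ge0.
(* the squared length of the component of [u] orthogonal to [v], cleared of
   denominators *)
have -> : dotp v v * (dotp u u * dotp v v) - dotp v v * dotp u v ^+ 2 =
    dotp (dotp v v *: u - dotp u v *: v) (dotp v v *: u - dotp u v *: v).
  set a := dotp v v; set b := dotp u v.
  have -> : dotp (a *: u - b *: v) (a *: u - b *: v) =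
      a ^+ 2 * dotp u u - (2 * a * b) * dotp u v + b ^+ 2 * dotp v v.
    clearbody a b; rewrite /dotp !mulr_sumr -sumrN -!big_split/=.
    by apply: eq_bigr => i _; rewrite !mxE; ring.
  by rewrite -/a -/b; ring.
exact: dotp_ge0.
Qed.

End Euclidean.

(** * Topology of the Euclidean ball and sphere *)

Section EuclideanTopology.
Variables (R : realType) (n : nat).

Lemma dotp_cvg (T : Type) (F : set_system T) (f g : T -> 'rV[R]_n)
    (u v : 'rV[R]_n) : Filter F ->
  f @ F --> u -> g @ F --> v -> dotp (f x) (g x) @[x --> F] --> dotp u v.
Proof.
move=> FF fu gv; apply: cvg_big => [|i _]; first exact: add_continuous.
apply: cvgM; first exact: cvg_comp fu (@coord_continuous _ _ _ _ _ _).
exact: cvg_comp gv (@coord_continuous _ _ _ _ _ _).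
Qed.

Lemma continuous_dotp (u : 'rV[R]_n) : continuous (dotp u).
Proof.
by move=> v; apply: (dotp_cvg _ (nbhs v) (fun=> u) id); first exact: cvg_cst.
Qed.

Lemma continuous_enorm : continuous (@enorm R n).
Proof.
move=> u; have uu := dotp_cvg _ _ id id u u (nbhs_filter u) cvg_id cvg_id.
exact: cvg_comp uu (@sqrt_continuous _ _).
Qed.

Lemma compact_eunit_ball : compact (@eunit_ball R n).
Proof.
apply: (@subclosed_compact _ (@eunit_ball R n)
  [set v : 'rV[R]_n | forall i, `[-1, 1]%classic (v ord0 i)]).
- apply: (closed_comp _ (@closed_le R 1)).
  by move=> u _; exact: continuous_enorm.
- exact (@rV_compact R n (fun=> `[-1, 1]%classic)
    (fun=> @segment_compact R _ _)).
- move=> v /= v1 i; rewrite in_itv/= -ler_norml.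
  exact: le_trans (coord_le_enorm _ _ v i) v1.
Qed.

Lemma closed_eunit_sphere : closed (@eunit_sphere R n).
Proof.
by apply: (closed_comp _ (@closed_eq R 1)) => u _; exact: continuous_enorm.
Qed.

End EuclideanTopology.

(** * Tangent cones *)

Section TangentCone.
Variables (R : realType) (V : normedModType R) (A : set V) (x : V).

(** In a metrizable space sequences can be replaced by neighbourhoods; this form
    is stable under closure and fits clustering filters. *)
Lemma tangent_coneP (w : V) : tangent_cone A x w <->
  forall (e : R) (N : set V), 0 < e -> nbhs w N ->
    exists t w', [/\ 0 < t, t < e, N w' & A (x + t *: w')].
Proof.
split=> [[t [wk [t0 tcvg wcvg Ak]]] e N e0 wN|wP].
  have te : \forall k \near \oo, t k < e by exact: (cvgr_lt 0).
  have Nk : \forall k \near \oo, N (wk k) by exact: wcvg.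
  have [k [tke Nwk]] := filter_ex (filterI te Nk).
  by exists (t k), (wk k).
have /choice[p pP] : forall k : nat, exists q : R * V, [/\ 0 < q.1,
    q.1 < k.+1%:R^-1, `|w - q.2| < k.+1%:R^-1 & A (x + q.1 *: q.2)].
  move=> k; have k0 : 0 < k.+1%:R^-1 :> R by rewrite invr_gt0.
  have [t [w' [t0 tk Nw' Aw']]] := wP _ _ k0 (nbhsx_ballx w _ k0).
  by exists (t, w'); split => //; move: Nw'; rewrite -ball_normE.
have small (e : R) : 0 < e -> \forall k \near \oo, k.+1%:R^-1 < e.
  by move=> e0; exact: near_infty_natSinv_lt (PosNum e0).
exists (fun k => (p k).1), (fun k => (p k).2); split.
- by move=> k; have [] := pP k.
- apply/cvgrPdist_lt => e /small; apply: filterS => k ke.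
  have [pk0 pk _ _] := pP k.
  by rewrite sub0r normrN gtr0_norm// (lt_trans pk).
- apply/cvgrPdist_lt => e /small; apply: filterS => k ke.
  by have [_ _ pk _] := pP k; exact: lt_trans ke.
- by move=> k; have [] := pP k.
Qed.

Lemma closed_tangent_cone : closed (tangent_cone A x).
Proof.
move=> w clw; apply/tangent_coneP => e N e0 wN.
have [v [/tangent_coneP vP Nv]] := clw _ (nbhs_interior wN).
have [t [w' [t0 te Nw' Aw']]] := vP _ _ e0 Nv.
by exists t, w'.
Qed.

End TangentCone.

(** * Lifting tangent vectors to the graph *)

Section Lift.
Variables (R : realType) (n m : nat).
Variables (S : 'rV[R]_n -> set 'rV[R]_m) (X : set 'rV[R]_n) (kappa : R).
Implicit Types (x w xs : 'rV[R]_n) (u us b : 'rV[R]_m).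

Lemma gph_restrict_map x u :
  gph (restrict_map S X) (x, u) <-> X x /\ S x u.
Proof.
rewrite /gph /restrict_map /patch/=; case: ifPn => [/set_mem|/negP] Xx.
  by split => // -[].
by split => // -[/mem_set].
Qed.

(** The Lipschitz inclusion turns each difference quotient [wk k] of [X] at [x]
    into a difference quotient [(wk k, - kappa |wk k| b k)] of the graph at
    [(x, u)].  The second components stay bounded, so they cluster by
    compactness of the ball; clustering the [b k] themselves keeps the constant
    [kappa] exact in the limit. *)
Lemma lipschitz_tangent_lift (V : set 'rV[R]_n) x u w :
  nbhs x V ->
  (forall y, (X `&` V) y -> exists2 b, eunit_ball b &
     S y (u - (kappa * enorm (x - y)) *: b)) ->
  tangent_cone X x w ->
  exists2 b, eunit_ball b &
    tangent_cone (gph (restrict_map S X)) (x, u)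
      (w, - (kappa * enorm w) *: b).
Proof.
move=> xV lip [t [wk [t0 tcvg wcvg Xk]]].
(* The inclusion is available only once [x + t k *: wk k] has entered [V];
   before that [b k] is arbitrary. *)
have /choice[b bP] : forall k, exists b : 'rV[R]_m, V (x + t k *: wk k) ->
    eunit_ball b /\
    S (x + t k *: wk k) (u + t k *: (- (kappa * enorm (wk k)) *: b)).
  move=> k; have [Vk|nVk] := pselect (V (x + t k *: wk k)); last by exists 0.
  have [b b1 Sb] := lip _ (conj (Xk k) Vk); exists b => _; split=> //.
  move: Sb; rewrite opprD addrA subrr sub0r -!scaleNr enormZ normrN gtr0_norm//.
  by rewrite !scaleNr scalerN scalerA mulrCA.
have Vk : \forall k \near \oo, V (x + t k *: wk k).
  have : (x + t k *: wk k) @[k --> \oo] --> x + 0 *: w.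
    by apply: cvgD; [exact: cvg_cst|exact: cvgZ].
  by rewrite scale0r addr0; apply.
have ballk : (b @ \oo) (@eunit_ball R m).
  by apply: filterS Vk => k /bP[].
have [c [c1 clc]] := compact_eunit_ball R m _ _ ballk.
exists c => //; apply/tangent_coneP => e N e0 wcN.
pose g (p : 'rV[R]_n * 'rV[R]_m) := (p.1, - (kappa * enorm p.1) *: p.2).
have gcvg : g @ nbhs (w, c) --> (w, - (kappa * enorm w) *: c).
  have p1 : p.1 @[p --> (w, c)] --> w by exact: cvg_fst.
  suff p2 : - (kappa * enorm p.1) *: p.2 @[p --> (w, c)] -->
      - (kappa * enorm w) *: c by exact: cvg_pair p1 p2.
  apply: cvgZ; last exact: cvg_snd.
  apply: cvgN; apply: cvgM; first exact: cvg_cst.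
  exact: cvg_comp p1 (@continuous_enorm _ _ _).
have [[N1 N2]/= [wN1 cN2] N12] := gcvg _ wcN.
(* Along a tail the quotients satisfy every condition except closeness of
   [b k] to [c], which clustering provides infinitely often. *)
have good : (b @ \oo) [set b' | exists k, [/\ b' = b k, t k < e,
    N1 (wk k) & V (x + t k *: wk k)]].
  have te : \forall k \near \oo, t k < e by exact: (cvgr_lt 0).
  have Nk : \forall k \near \oo, N1 (wk k) by exact: wcvg.
  apply: filterS (filterI te (filterI Nk Vk)) => k [tke [Nwk Vwk]].
  by exists k.
have [_ [[k [-> tke Nwk Vwk]] N2b]] := clc _ _ good cN2.
exists (t k), (g (wk k, b k)); split => //; first exact: (N12 (wk k, b k)).
by apply/gph_restrict_map; split; [exact: Xk|have [] := bP k Vwk].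
Qed.

(** The minus sign on [us] in the coderivative meets the minus sign of the
    lifted vector, and Cauchy-Schwarz bounds [- <us, b>] by [|us|]. *)
Lemma coderivative_tangent_le x u us xs w b :
  0 <= kappa -> eunit_ball b -> enorm w = 1 ->
  regular_coderivative (restrict_map S X) x u us xs ->
  tangent_cone (gph (restrict_map S X)) (x, u) (w, - (kappa * enorm w) *: b) ->
  dotp xs w <= kappa * enorm us.
Proof.
move=> k0 b1 w1 Dxs /Dxs; rewrite /dotp_pair/= w1 mulr1 dotpNl dotpZr.
rewrite mulNr opprK => le0.
have usb : - dotp us b <= enorm us.
  apply: (le_trans (ler_norm _)); rewrite normrN.
  by apply: (le_trans (cauchy_schwarz _ _ _ _)); rewrite ler_piMr ?enorm_ge0.
have : kappa * - dotp us b <= kappa * enorm us by rewrite ler_wpM2l.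
lra.
Qed.

End Lift.

(** * The coderivative condition *)

Lemma is_emax_compact (R : realType) (T : topologicalType) (A : set T)
    (f : T -> R) : compact A -> continuous f ->
  exists M, is_emax [set (f w)%:E | w in A] M.
Proof.
move=> cA cf; have [->|A0] := eqVneq A set0.
  by exists -oo%E; right; rewrite image_set0.
have [||c /set_mem Ac cmax] := @compact_EVT_max _ R f A _ cA.
- exact/set0P.
- exact: continuous_subspaceT.
exists (f c)%:E; left; split; first by exists c.
by move=> _ [w Aw <-]; rewrite lee_fin cmax ?mem_set.
Qed.

Theorem theorem2p1 (R : realType) (n m : nat)
    (S : 'rV[R]_n -> set 'rV[R]_m) (X : set 'rV[R]_n)
    (xbar : 'rV[R]_n) (ubar : 'rV[R]_m) (kappa : R)
    (Xxbar : X xbar) (Subar : S xbar ubar) (kappa_ge0 : 0 <= kappa)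
    (Xclosed : closed X)
    (SLip : lipschitz_like S X xbar ubar kappa) :
  \forall z \near within (gph (restrict_map S X)) (nbhs (xbar, ubar)),
    coderivative_condition S X kappa z.1 z.2.
Proof.
have [_ [V [W [nV nW lip]]]] := SLip.
rewrite near_withinE.
(* The interior, because [V] must be a neighbourhood of every nearby [x], so
   that it captures the points of [X] tending to [x]. *)
exists (V°, W); first by split => //=; exact: nbhs_interior.
move=> [x u] /= [xV Wu] /gph_restrict_map[Xx Sxu] us xs Dxs.
have lipx y : (X `&` V) y ->
    exists2 b : 'rV[R]_m, eunit_ball b & S y (u - (kappa * enorm (x - y)) *: b).
  move=> XVy.
  have XVx : (X `&` V) x by split => //; exact: nbhs_singleton.
  have [u' Su' [b b1 ub]] := lip _ _ XVy XVx _ (conj Sxu Wu).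
  by exists b => //; rewrite -ub addrK.
have bound w : (tangent_cone X x `&` @eunit_sphere R n) w ->
    dotp xs w <= kappa * enorm us.
  move=> [Tw w1].
  have [b b1 Tb] := @lipschitz_tangent_lift _ _ _ _ _ _ _ _ _ _ xV lipx Tw.
  exact: coderivative_tangent_le b1 w1 Dxs Tb.
have cTS : compact (tangent_cone X x `&` @eunit_sphere R n).
  apply: subclosed_compact (compact_eunit_ball R n) _.
    by apply: closedI; [exact: closed_tangent_cone|exact: closed_eunit_sphere].
  by move=> w [_]; rewrite /eunit_sphere /eunit_ball /= => ->.
have [M maxM] := @is_emax_compact _ _ _ _ cTS (@continuous_dotp R n xs).
exists M; split=> //.
case: maxM => [[[w TSw <-] _]|[_ ->]]; last exact: leNye.
by rewrite lee_fin bound.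
Qed.
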